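(* Let $\mathcal{I}$ be an ideal on $\mathbb{N}$. If there exists an $\mathcal{I}$-AD family of cardinality $\mathfrak{c}$ (the cardinality of the continuum), then there is a rich abstract upper density $\delta$ such that $\mathcal{Z}_\delta=\mathcal{I}$.
   Context: An abstract upper density on $\mathbb{N}$ is a function $\delta:\mathcal{P}(\mathbb{N})\to[0,1]$ such that $\delta(\mathbb{N})=1$; $\delta(F)=0$ for every finite $F\subseteq\mathbb{N}$; $A\subseteq B$ implies $\delta(A)\le\delta(B)$; and $\delta(A\cup B)\le\delta(A)+\delta(B)$. It is rich if for every $r\in[0,1]$ there is $A\subseteq\mathbb{N}$ with $\delta(A)=r$. $\mathcal{Z}_\delta=\{A\subseteq\mathbb{N}:\delta(A)=0\}$. An ideal on $\mathbb{N}$ is a family $\mathcal{I}\subseteq\mathcal{P}(\mathbb{N})$ closed under finite unions and subsets, containing all finite subsets of $\mathbb{N}$, with $\mathbb{N}\notin\mathcal{I}$. $\mathcal{I}^+=\{A\subseteq\mathbb{N}:A\notin\mathcal{I}\}$. A family $\mathcal{A}\subseteq\mathcal{P}(\mathbb{N})$ is an $\mathcal{I}$-AD family if $\mathcal{A}\subseteq\mathcal{I}^+$ and $A\cap B\in\mathcal{I}$ for all distinct $A,B\in\mathcal{A}$. *)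

(* Defs.v *)
From mathcomp Require Import all_boot all_order all_algebra.
From mathcomp Require Import all_classical all_reals.

Set Implicit Arguments.
Unset Strict Implicit.
Unset Printing Implicit Defensive.

Import Order.TTheory GRing.Theory Num.Theory.
Local Open Scope classical_set_scope.
Local Open Scope ring_scope.

Record abstract_upper_density (R : realType) (delta : set nat -> R) : Prop := {
  aud_range : forall A, 0 <= delta A <= 1 ;
  aud_setT : delta setT = 1 ;
  aud_finite : forall F, finite_set F -> delta F = 0 ;
  aud_mono : forall A B, A `<=` B -> delta A <= delta B ;
  aud_subadd : forall A B, delta (A `|` B) <= delta A + delta B }.

Definition rich (R : realType) (delta : set nat -> R) : Prop :=
  forall r : R, 0 <= r <= 1 -> exists A : set nat, delta A = r.

Definition zero_sets (R : realType) (delta : set nat -> R) : set (set nat) :=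
  [set A | delta A = 0].

(* The empty union is covered by [ideal_finite]. *)
Record is_ideal (I : set (set nat)) : Prop := {
  ideal_setU : forall A B, I A -> I B -> I (A `|` B) ;
  ideal_sub : forall A B, A `<=` B -> I B -> I A ;
  ideal_finite : forall F, finite_set F -> I F ;
  ideal_proper : ~ I setT }.

Definition positive_sets (I : set (set nat)) : set (set nat) :=
  [set A | ~ I A].

Definition AD_family (I : set (set nat)) (F : set (set nat)) : Prop :=
  F `<=` positive_sets I /\
  (forall A B, F A -> F B -> A <> B -> I (A `&` B)).

(* Main.v *)
(** Index the almost disjoint family by the reals as [(f x)] and let [I_t] be
    the ideal generated by [I] and the sets [f x] with [0 < x <= t]. The density
    of [A] is the infimum of [1] and all [t >= 0] with [A] in [I_t]. It is
    subadditive because [I_t] is an ideal increasing in [t]. Almost disjointness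
    says that a positive part of [f x] is never covered modulo [I] by finitely
    many other members of the family; hence [f x] has density exactly [x] for
    [0 < x <= 1], and a set of density [0] lies in [I]. *)
Require Import Defs.
From mathcomp Require Import all_boot all_order all_algebra.
From mathcomp Require Import all_classical all_reals.

Set Implicit Arguments.
Unset Strict Implicit.
Unset Printing Implicit Defensive.

Import Order.TTheory GRing.Theory Num.Theory.

Local Open Scope classical_set_scope.
Local Open Scope card_scope.
Local Open Scope ring_scope.

Definition seq_union (T : eqType) (f : T -> set nat) (s : seq T) : set nat :=
  [set n | exists2 x, x \in s & f x n].

Lemma ideal_setI_seq_union (T : eqType) (I : set (set nat)) (f : T -> set nat)
    (s : seq T) (B : set nat) :
  is_ideal I -> (forall x, x \in s -> I (B `&` f x)) ->
  I (B `&` seq_union f s).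
Proof.
move=> hI; elim: s => [|x s IHs] hB.
  by apply: (ideal_sub hI _ (ideal_finite hI (finite_set0 nat))) => n [_ [x]].
have Ix := hB x (mem_head x s).
have Is : I (B `&` seq_union f s).
  by apply: IHs => y ys; apply: hB; rewrite inE ys orbT.
apply: (ideal_sub hI _ (ideal_setU hI Ix Is)) => n [Bn [y]].
rewrite inE => /predU1P[-> | ys] fyn; first by left.
by right; split=> //; exists y.
Qed.

Lemma ideal_covered (T : eqType) (I : set (set nat)) (f : T -> set nat)
    (s : seq T) (A : set nat) :
  is_ideal I -> I (A `\` seq_union f s) ->
  (forall x, x \in s -> I (A `&` f x)) -> I A.
Proof.
move=> hI hD hs.
apply: (ideal_sub hI _ (ideal_setU hI hD (ideal_setI_seq_union hI hs))).
by move=> n An; have [?|?] := pselect (seq_union f s n); [right | left].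
Qed.

(** Since [x] does not occur in [s], almost disjointness puts each [f y] with [y] in [s] almost off
    [f x], so a cover of [A] modulo [I] by these sets leaves almost nothing of [A] inside [f x]. *)
Lemma ideal_covered_setI (T : eqType) (I : set (set nat)) (f : T -> set nat)
    (s : seq T) (A : set nat) (x : T) :
  is_ideal I -> (forall y z, y <> z -> I (f y `&` f z)) -> x \notin s ->
  I (A `\` seq_union f s) -> I (A `&` f x).
Proof.
move=> hI fAD xs hA; apply: (ideal_covered (f := f) (s := s) hI).
  by apply: (ideal_sub hI _ hA) => n [[An _] sn].
move=> y ys; have xy : x <> y by move=> xy; rewrite xy ys in xs.
by apply: (ideal_sub hI _ (fAD _ _ xy)) => n [[_ fx] fy].
Qed.

(** The list may be empty, so every level contains [I]; the strict bound [0 < x] makes level [0]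
    equal to [I] when [I] is an ideal. *)
Definition level_ideal (R : realType) (I : set (set nat)) (f : R -> set nat)
    (t : R) : set (set nat) :=
  [set A | exists2 s : seq R,
    {in s, forall x, 0 < x <= t} & I (A `\` seq_union f s)].

Lemma level_ideal_sub (R : realType) (I : set (set nat)) (f : R -> set nat)
    (t u : R) (A B : set nat) :
  is_ideal I -> t <= u -> A `<=` B -> level_ideal I f t B ->
  level_ideal I f u A.
Proof.
move=> hI tu AB [s hs hB]; exists s.
  by move=> x /hs /andP[-> xt]; apply: le_trans tu.
by apply: (ideal_sub hI _ hB) => n [/AB].
Qed.

Lemma level_ideal_setU (R : realType) (I : set (set nat)) (f : R -> set nat)
    (t : R) (A B : set nat) :
  is_ideal I -> level_ideal I f t A -> level_ideal I f t B ->
  level_ideal I f t (A `|` B).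
Proof.
move=> hI [s hs hA] [s' hs' hB]; exists (s ++ s').
  by move=> x; rewrite mem_cat => /orP[/hs | /hs'].
apply: (ideal_sub hI _ (ideal_setU hI hA hB)) => n [[An|Bn] hn]; [left|right];
  split=> // -[x xs fx]; apply: hn; exists x => //;
  by rewrite mem_cat xs ?orbT.
Qed.

Lemma level_ideal_mem (R : realType) (I : set (set nat)) (f : R -> set nat)
    (x : R) :
  is_ideal I -> 0 < x -> level_ideal I f x (f x).
Proof.
move=> hI x0; exists [:: x].
  by move=> y; rewrite inE => /eqP ->; rewrite x0 lexx.
apply: (ideal_sub hI _ (ideal_finite hI (finite_set0 nat))) => n [fx].
by apply; exists x => //; rewrite mem_head.
Qed.

(** Source of all lower bounds on the density: indices at level [t] are at most [t], so [x] is not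
    among them. *)
Lemma level_ideal_setI (R : realType) (I : set (set nat)) (f : R -> set nat)
    (t x : R) (A : set nat) :
  is_ideal I -> (forall y z, y <> z -> I (f y `&` f z)) -> t < x ->
  level_ideal I f t A -> I (A `&` f x).
Proof.
move=> hI fAD tx [s hs hA]; apply: ideal_covered_setI hA => //.
by apply/negP => /hs /andP[_]; rewrite leNgt tx.
Qed.

(** The disjunct [1 <= t] caps the infimum at [1] and keeps the set nonempty, so [inf] never takes
    its default value. *)
Definition levels (R : realType) (I : set (set nat)) (f : R -> set nat)
    (A : set nat) : set R :=
  [set t | 0 <= t /\ (1 <= t \/ level_ideal I f t A)].

Definition level_density (R : realType) (I : set (set nat)) (f : R -> set nat)
    (A : set nat) : R := inf (levels I f A).

Lemma levels1 (R : realType) (I : set (set nat)) (f : R -> set nat)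
    (A : set nat) : levels I f A 1.
Proof. by split; [exact: ler01 | left]. Qed.

Lemma has_inf_levels (R : realType) (I : set (set nat)) (f : R -> set nat)
    (A : set nat) : has_inf (levels I f A).
Proof. by split; [exists 1; exact: levels1 | exists 0 => t []]. Qed.

Lemma level_density_le (R : realType) (I : set (set nat)) (f : R -> set nat)
    (A : set nat) (t : R) : levels I f A t -> level_density I f A <= t.
Proof. by move=> At; apply: ge_inf => //; case: (has_inf_levels I f A). Qed.

Lemma level_density_ge (R : realType) (I : set (set nat)) (f : R -> set nat)
    (A : set nat) (u : R) :
  (forall t, levels I f A t -> u <= t) -> u <= level_density I f A.
Proof. by move=> h; apply: lb_le_inf => //; exists 1; exact: levels1. Qed.

Lemma level_density_lt (R : realType) (I : set (set nat)) (f : R -> set nat)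
    (A : set nat) (u : R) :
  level_density I f A < u -> exists2 t, levels I f A t & t < u.
Proof. by move=> /inf_lt; apply; exists 1; exact: levels1. Qed.

Lemma level_density_ge0 (R : realType) (I : set (set nat)) (f : R -> set nat)
    (A : set nat) : 0 <= level_density I f A.
Proof. by apply: level_density_ge => t []. Qed.

Lemma level_density_le1 (R : realType) (I : set (set nat)) (f : R -> set nat)
    (A : set nat) : level_density I f A <= 1.
Proof. exact/level_density_le/levels1. Qed.

Lemma level_density_subset (R : realType) (I : set (set nat))
    (f : R -> set nat) (A B : set nat) :
  is_ideal I -> A `<=` B -> level_density I f A <= level_density I f B.
Proof.
move=> hI AB; apply: level_density_ge => t [t0 ht]; apply: level_density_le.
split=> //; case: ht => ht; [by left | right].
exact: level_ideal_sub hI (lexx t) AB ht.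
Qed.

(** Were the density of the union above both others, [A] and [B] would have levels [t] and [u]
    strictly below it; but the larger of [t] and [u] is a level of the union. *)
Lemma level_density_setU (R : realType) (I : set (set nat))
    (f : R -> set nat) (A B : set nat) :
  is_ideal I ->
  level_density I f (A `|` B) <=
    Num.max (level_density I f A) (level_density I f B).
Proof.
move=> hI; rewrite leNgt gt_max; apply/negP => /andP[].
move=> /level_density_lt[t [t0 ht] tAB] /level_density_lt[u [u0 hu] uAB].
have : level_density I f (A `|` B) <= Num.max t u.
  apply: level_density_le; split; first by rewrite le_max t0.
  case: ht => [t1 | ht]; first by left; rewrite le_max t1.
  case: hu => [u1 | hu]; first by left; rewrite le_max u1 orbT.
  right; apply: level_ideal_setU => //.
    by apply: level_ideal_sub hI _ (@subset_refl _ A) ht; rewrite le_max lexx.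
  by apply: level_ideal_sub hI _ (@subset_refl _ B) hu; rewrite le_max lexx orbT.
by rewrite leNgt gt_max tAB uAB.
Qed.

Lemma level_density_eq0 (R : realType) (I : set (set nat))
    (f : R -> set nat) (A : set nat) :
  is_ideal I -> (forall y z, y <> z -> I (f y `&` f z)) ->
  level_density I f A = 0 <-> I A.
Proof.
move=> hI fAD; split=> [A0 | IA]; last first.
  apply/eqP; rewrite eq_le level_density_ge0 andbT.
  apply: level_density_le; split=> //; right; exists [::] => //.
  by apply: (ideal_sub hI _ IA) => n [].
(* The infimum [0] need not be attained, but there are levels below any positive [u]; [u <= 1]
   excludes the disjunct [1 <= t]. *)
have small u : 0 < u -> u <= 1 -> exists2 t, t < u & level_ideal I f t A.
  move=> u0 u1; have := u0; rewrite -{1}A0 => /level_density_lt[t [_ ht] tu].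
  exists t => //; case: ht => // t1.
  by have := lt_le_trans tu u1; rewrite ltNge t1.
(* Fix one finite cover [s] of [A]. For each index [x] in it, a second cover from a level below [x]
   shows that [A] meets [f x] in a set of [I]. *)
have [t t1 [s hs hA]] := small 1 ltr01 (lexx 1).
apply: (ideal_covered hI hA) => x /hs /andP[x0 xt].
have [u ux hu] := small x x0 (le_trans xt (ltW t1)).
exact: level_ideal_setI hu.
Qed.

Lemma level_density_setT (R : realType) (I : set (set nat))
    (f : R -> set nat) :
  is_ideal I -> (forall y z, y <> z -> I (f y `&` f z)) ->
  (forall x, ~ I (f x)) -> level_density I f setT = 1.
Proof.
move=> hI fAD fpos; apply/eqP; rewrite eq_le level_density_le1 /=.
apply: level_density_ge => t [_ [// | ht]]; rewrite leNgt; apply/negP => t1.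
(* The contradiction comes from the member [f 1], whose index exceeds [t]. *)
by have := level_ideal_setI hI fAD t1 ht; rewrite setTI; exact: fpos.
Qed.

Lemma level_density_mem (R : realType) (I : set (set nat))
    (f : R -> set nat) (x : R) :
  is_ideal I -> (forall y z, y <> z -> I (f y `&` f z)) ->
  (forall y, ~ I (f y)) -> 0 < x <= 1 -> level_density I f (f x) = x.
Proof.
move=> hI fAD fpos /andP[x0 x1]; apply/eqP; rewrite eq_le; apply/andP; split.
  apply: level_density_le; split; [exact: ltW | right].
  exact: level_ideal_mem.
apply: level_density_ge => t [_ [t1 | ht]]; first exact: le_trans t1.
rewrite leNgt; apply/negP => tx.
by have := level_ideal_setI hI fAD tx ht; rewrite setIid; exact: fpos.
Qed.

Theorem theorem2p1 (R : realType) (I : set (set nat)) (hI : is_ideal I)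
    (hAD : exists F : set (set nat), AD_family I F /\ F #= [set: R]) :
  exists delta : set nat -> R,
    [/\ abstract_upper_density delta, rich delta & zero_sets delta = I].
Proof.
(* Equality of cardinalities lets the reals index members of [F] injectively, so distinct indices
   give almost disjoint sets. *)
have [F [[Fpos FAD] /card_esym /card_set_bijP[f [fF finj _]]]] := hAD.
have fpos x : ~ I (f x) by apply/Fpos/fF.
have fAD y z : y <> z -> I (f y `&` f z).
  move=> yz; apply: FAD; [exact: fF | exact: fF |].
  by move=> /finj fyz; apply: yz; apply: fyz; rewrite inE.
exists (level_density I f); split.
- split.
  + by move=> A; rewrite level_density_ge0 level_density_le1.
  + exact: level_density_setT.
  + by move=> A Afin; apply/level_density_eq0 => //; exact: ideal_finite.
  + by move=> A B; exact: level_density_subset.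
  (* The maximum of two nonnegative numbers is at most their sum. *)
  + move=> A B; apply: le_trans (level_density_setU _ _ _ hI) _.
    by rewrite ge_max lerDl lerDr !level_density_ge0.
(* The value [0] needs its own witness: [f 0] is not in [I], so its density is positive. *)
- move=> r /andP[]; rewrite le_eqVlt => /predU1P[<- _ | r0 r1].
    by exists set0; apply/level_density_eq0 => //; exact: ideal_finite.
  by exists (f r); apply: level_density_mem => //; rewrite r0.
- by apply/seteqP; split=> A; rewrite /zero_sets /= level_density_eq0.
Qed.
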